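(* Let $\mathbb{X}=(X,\{X_v\}_{v\in V(X)})$ be a finite edge-trivial graph of groups. Let $n=\#V(X)$, let $m$ be the number of edges of $X$, let $l$ be the number of legs of $X$, and let $b_1(X)=m-n+1$. Let $A$, $Q$, $C$ be the $n\times n$ adjacency, valency and charge matrices of $\mathbb{X}$, indexed by $V(X)$: $$A_{uv}=\#\{h\in H(X): r(h)=u,\ r(\overline{h})=v\},\qquad Q_{uv}=\delta_{uv}\,\mathrm{val}(v),\qquad C_{uv}=\delta_{uv}\,\#(X_v).$$ Then the Ihara zeta function of $\mathbb{X}$ satisfies $$\zeta(u,\mathbb{X})^{-1}=(1-u^2)^{b_1(X)-1}(1+u)^l\det\bigl(I_n-CAu+(CQ-I_n)u^2\bigr).$$
   Context: Graphs. A graph (with legs) $X$ consists of a set of vertices $V(X)$, a set of half-edges $H(X)$, a root map $r:H(X)\to V(X)$, and an involution $h\mapsto\overline{h}$ on $H(X)$. The valency of $v$ is $\mathrm{val}(v)=\#(r^{-1}(v))$. An orbit $\{h,\overline h\}$ of size 2 is an edge; a half-edge with $\overline h=h$ is a leg. All graphs are connected. A finite edge-trivial graph of groups $\mathbb{X}=(X,X_v)$ consists of a finite graph $X$ and a finite group $X_v$ for each $v\in V(X)$. A path of length $n\ge 1$ in $\mathbb{X}$ is a sequence $P=g_0h_1g_1h_2\cdots g_{n-1}h_n$ where $h_j\in H(X)$, $r(h_{j+1})=r(\overline{h_j})$ for $1\le j\le n-1$, and, setting $v_0=r(h_1)$, $v_j=r(\overline{h_j})$ for $1\le j\le n$, one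 has $g_j\in X_{v_j}$ for $0\le j\le n-1$. It is closed if $v_n=v_0$; closed paths have positive integer powers by concatenation. With indices taken modulo $n$, a closed path is reduced if for every $j\in\{1,\dots,n\}$ either $h_{j+1}\ne\overline{h_j}$ or $g_j\neq 1$. A closed reduced path $P$ is primitive if there is no path $R$ and $k\ge2$ with $P=R^k$. Two closed paths of the same length $n$ are equivalent if they differ by a cyclic shift, i.e. $g'_{j-1}=g_{j-1+s}$ and $h'_j=h_{j+s}$ for some $0\le s\le n-1$ and all $j\in\{1,\dots,n\}$. A prime $\mathfrak{p}$ of $\mathbb{X}$ is an equivalence class of primitive paths; $\ell(\mathfrak p)$ is the common length. The Ihara zeta function is $\zeta(u,\mathbb{X})=\prod_{\mathfrak p}(1-u^{\ell(\mathfrak p)})^{-1}$, the product over all primes of $\mathbb{X}$, which converges for sufficiently small complex $u$. *)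

(* Defs.v *)
From HB Require Import structures.
From mathcomp Require Import all_boot all_order all_fingroup all_algebra.
From mathcomp Require Import finmap.
From mathcomp Require Import all_classical all_reals all_analysis.
From mathcomp.analysis.showcase Require summability.
From mathcomp Require Import complex.

Set Implicit Arguments.
Unset Strict Implicit.
Unset Printing Implicit Defensive.

Import Order.TTheory GRing.Theory Num.Theory.
Import numFieldNormedType.Exports.

Local Open Scope classical_set_scope.
Local Open Scope ring_scope.

(* Finite graphs with legs, in the half-edge formalism. *)
Record leg_graph := LegGraph {
  vertex : finType;
  half_edge : finType;
  vroot : half_edge -> vertex;
  hbar : half_edge -> half_edge;
  hbarK : involutive hbar
}.

Section Graph.
Variable X : leg_graph.

Definition adjacent : rel (vertex X) :=
  [rel x y | [exists h, (vroot h == x) && (vroot (hbar h) == y)]].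

(* The empty graph is not connected. *)
Definition connected_graph : Prop :=
  (0 < #|vertex X|)%N /\ forall x y : vertex X, connect adjacent x y.

Definition valency (x : vertex X) : nat :=
  #|[set h : half_edge X | vroot h == x]%SET|.

Definition nb_vertices : nat := #|vertex X|.

Definition edges : {set {set half_edge X}} :=
  [set [set h; hbar h] | h : half_edge X & hbar h != h]%SET.

Definition legs : {set half_edge X} := [set h | hbar h == h]%SET.

Definition betti1 : int := #|edges|%:Z - nb_vertices%:Z + 1.

End Graph.

Record graph_of_groups := GraphOfGroups {
  gog_graph :> leg_graph;
  vgroup : vertex gog_graph -> finGroupType
}.

Section Paths.
Variable X : graph_of_groups.

(* A path g_0 h_1 g_1 ... g_{n-1} h_n is encoded as the sequence of its steps
   (h_j, g_{j-1}), j = 1, ..., n; since v_{j-1} = r(h_j) along a path, g_{j-1}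
   is an element of X_{r(h_j)}. *)
Definition step : finType := {h : half_edge X & vgroup (vroot h)}.

Definition step_edge (s : step) : half_edge X := tag s.
Definition step_elt (s : step) : vgroup (vroot (step_edge s)) := tagged s.

Definition consecutive : rel step :=
  [rel s t | vroot (step_edge t) == vroot (hbar (step_edge s))].

Definition no_backtrack : rel step :=
  [rel s t | (step_edge t != hbar (step_edge s)) || (step_elt t != 1%g)].

(* [path.cycle] also relates the last step to the first one: this gives
   v_n = v_0 for [consecutive], and the case j = n for [no_backtrack]. *)
Definition closed_path (P : seq step) : bool :=
  (P != [::]) && path.cycle consecutive P.

Definition reduced_path (P : seq step) : bool := path.cycle no_backtrack P.

Definition path_power (R : seq step) (k : nat) : seq step :=
  flatten (nseq k R).

Definition primitive_path (P : seq step) : Prop :=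
  [/\ closed_path P, reduced_path P &
      ~ exists (R : seq step) (k : nat),
          [/\ closed_path R, (2 <= k)%N & P = path_power R k]].

Definition cyclic_equiv (P P' : seq step) : Prop :=
  exists2 s, (s < size P)%N & P' = rot s P.

Definition path_class (P : seq step) : set (seq step) :=
  [set P' | cyclic_equiv P P'].

Definition primes_of : set (set (seq step)) :=
  [set path_class P | P in primitive_path].

Definition prime_of : choiceType := set_type primes_of.

(* The size of any representative: they all have the same size. *)
Definition prime_length (p : prime_of) : nat :=
  size (xget [::] (set_val p)).

End Paths.

Section Zeta.
Variables (K : numFieldType) (X : graph_of_groups).

Definition euler_partial (u : K) (F : {fset prime_of X}) : K :=
  \prod_(p <- F) (1 - u ^+ prime_length p)^-1.

(* Unordered infinite product: the limit of the partial products over the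
   finite sets of primes, directed by inclusion. *)
Definition ihara_zeta (u : K) : K :=
  lim (euler_partial u @ summability.totally).

(* As usual for infinite products, convergence includes a nonzero limit. *)
Definition zeta_converges (u : K) : Prop :=
  cvg (euler_partial u @ summability.totally) /\ ihara_zeta u != 0.

End Zeta.

(* Square matrices indexed by V(X), through the enumeration
   [enum_val : 'I_(nb_vertices X) -> vertex X]. *)
Section Matrices.
Variables (K : pzRingType) (X : graph_of_groups).

Definition vertex_at (i : 'I_(nb_vertices X)) : vertex X := enum_val i.

Definition adjacency_mx : 'M[K]_(nb_vertices X) :=
  \matrix_(i, j) #|[set h : half_edge X | (vroot h == vertex_at i) &&
                      (vroot (hbar h) == vertex_at j)]%SET|%:R.

Definition valency_mx : 'M[K]_(nb_vertices X) :=
  diag_mx (\row_i (valency (vertex_at i))%:R).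

Definition charge_mx : 'M[K]_(nb_vertices X) :=
  diag_mx (\row_i #|vgroup (vertex_at i)|%:R).

End Matrices.

(* Main.v *)
Require Import Defs.
From mathcomp Require Import all_boot all_order all_fingroup all_algebra.
From mathcomp Require Import ring zify finmap.
From mathcomp Require Import all_classical all_reals all_analysis.
From mathcomp.analysis.showcase Require summability.
From mathcomp Require Import complex.

(** The Euler product is [det (1 - u W)], where [W] is the 0/1 matrix of allowed
    transitions between steps.  Both sides have the same logarithmic derivative
    up to any order [N]: for [j <= N], the trace of [W^j] counts the closed reduced
    paths of length [j], and each of these is uniquely a rotation of a power of a prime,
    so the count is the sum of the lengths of the primes whose length divides [j].
    Hence a finite Euler product containing all primes of length at most [N] has the
    same coefficients as [det (1 - u W)] up to order [N]; all its coefficients are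
    bounded by those of [prod (1 + X^l)], which is bounded at a small radius because
    there are at most [#|step|^n] primes of length [n], and this yields the limit.

    Two uses of [det (1 - A B) = det (1 - B A)] bring [det (1 - u W)] down to half-edges,
    where it is [det (1 + u J - u S C T)] with [J] the matrix of the involution, and then
    to vertices; [det (1 + u J)] contributes [(1 - u^2)^m (1 + u)^l]. *)

Import Order.TTheory GRing.Theory Num.Theory.
Import numFieldNormedType.Exports.
Local Open Scope classical_set_scope.
Local Open Scope ring_scope.
Local Open Scope complex_scope.

(** * Periods and roots of cyclic words *)

Section Words.
Local Open Scope nat_scope.
Context {T : eqType}.
Implicit Types (v w x y : seq T) (d k : nat).

Definition wpower v k : seq T := flatten (nseq k v).

Lemma wpowerS v k : wpower v k.+1 = v ++ wpower v k.
Proof. by []. Qed.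

Lemma size_wpower v k : size (wpower v k) = (k * size v).
Proof. by elim: k => // k IH; rewrite wpowerS size_cat IH mulSn. Qed.

Lemma wpower_conj x y k : x ++ wpower (y ++ x) k = wpower (x ++ y) k ++ x.
Proof.
elim: k => [|k IH]; first by rewrite /= cats0.
by rewrite !wpowerS -!catA IH.
Qed.

Lemma rot_wpower d v k : (d <= size v) -> (0 < k) ->
  rot d (wpower v k) = wpower (rot d v) k.
Proof.
case: k => // k dv _; rewrite -{1}(cat_take_drop d v) wpowerS -catA.
rewrite {1}(_ : d = size (take d v)) ?rot_size_cat; last by rewrite size_takel.
rewrite -catA /rot wpowerS -catA; congr (_ ++ _).
by rewrite wpower_conj.
Qed.

Lemma rot_iter d w : (d <= size w) -> rot d w = iter d (rot 1) w.
Proof.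
elim: d => [|d IH] dw; first by rewrite rot0.
by rewrite iterS -IH 1?ltnW // rotS.
Qed.

Lemma rot_iterM d w : iter d (rot 1) w = w ->
  forall k, iter (k * d) (rot 1) w = w.
Proof. by move=> wd; elim=> // k IH; rewrite mulSn iterD IH. Qed.

(* The periods of a cyclic word are closed under Bezout combinations. *)
Lemma rot_gcdn d k w : (0 < d) -> (d <= size w) -> (k <= size w) ->
  rot d w = w -> rot k w = w -> rot (gcdn d k) w = w.
Proof.
move=> d0 dw kw; rewrite (rot_iter d) // (rot_iter k) // => wd wk.
rewrite rot_iter; last by rewrite (leq_trans _ dw) // dvdn_leq // dvdn_gcdl.
case: (egcdnP k d0) => a b ab _.
have := rot_iterM _ _ wd a; rewrite ab addnC iterD.
by rewrite (rot_iterM _ _ wk b).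
Qed.

(** Comparing prefixes shows that [x] begins with [v]; cancelling that copy preserves the
    commutation, so induction on [k] applies. *)
Lemma wpower_comm v x k : size x = (k * size v) -> v ++ x = x ++ v ->
  x = wpower v k.
Proof.
elim: k x => [|k IH] x; first by move/size0nil.
rewrite mulSn => sx vx.
have vE : take (size v) x = v.
  have := congr1 (take (size v)) vx; rewrite take_size_cat //.
  by rewrite takel_cat ?sx ?leq_addr // => <-.
rewrite -(cat_take_drop (size v) x) vE wpowerS; congr (_ ++ _).
apply: IH; first by rewrite size_drop sx addKn.
by move: vx; rewrite -{1 2}(cat_take_drop (size v) x) vE -catA => /eqP;
   rewrite eqseq_cat // eqxx => /eqP.
Qed.

Lemma rot_dvdn d w : (0 < d) -> (d %| size w) -> rot d w = w ->
  w = wpower (take d w) (size w %/ d).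
Proof.
move=> d0 dw rw; have [/size0nil->|w0] := posnP (size w).
  by rewrite div0n.
have dlw : (d <= size w) by rewrite dvdn_leq.
have st : size (take d w) = d by rewrite size_takel.
have [k wE] : exists k, (size w %/ d = k.+1).
  by exists (size w %/ d).-1; rewrite prednK // divn_gt0.
rewrite wE wpowerS -{1}(cat_take_drop d w); congr (_ ++ _).
apply: wpower_comm; last by rewrite cat_take_drop.
by rewrite size_drop st -{1}(divnK dw) wE mulSn addKn.
Qed.

Definition aperiodic w : bool :=
  (w != [::]) && all (fun d => rot d w != w) (iota 1 (size w).-1).

Lemma aperiodicP w : reflect
  ((0 < size w) /\ forall d, (d < size w) -> rot d w = w -> d = 0%N)
  (aperiodic w).
Proof.
rewrite /aperiodic -size_eq0 -lt0n.
apply: (iffP andP) => -[w0 H]; split => //.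
  move=> d dw wd; apply/eqP; rewrite -leqn0 leqNgt; apply/negP => d0.
  move/allP: H => /(_ d); rewrite mem_iota d0 add1n prednK // dw => /(_ isT).
  by rewrite wd eqxx.
apply/allP => d; rewrite mem_iota add1n prednK // => /andP[d0 dw].
by apply/eqP => /(H _ dw) d00; rewrite d00 in d0.
Qed.

Lemma aperiodic_rot d w : aperiodic (rot d w) = aperiodic w.
Proof.
apply/aperiodicP/aperiodicP; rewrite size_rot => -[w0 H]; split => // k kw wk.
  by apply: H => //; rewrite rot_rot wk.
by apply: H => //; apply: (can_inj (rotK d)); rewrite -rot_rot.
Qed.

Lemma rot_aperiodic_inj w i j : aperiodic w -> (i < size w) ->
  (j < size w) -> rot i w = rot j w -> i = j.
Proof.
move=> /aperiodicP[w0 H].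
wlog ij : i j / (i <= j).
  move=> W iw jw ij; case: (leqP i j) => [|/ltnW] h; first exact: W.
  exact/esym/W.
move=> iw jw; rewrite -{1}(subnK ij) addnC rotD ?subnKC ?(ltnW jw) //.
move=> /(can_inj (rotK i)) /esym/H.
have jiw : (j - i < size w) by exact: leq_ltn_trans (leq_subr _ _) jw.
by move/(_ jiw) => /eqP; rewrite subn_eq0 => ji; apply/eqP; rewrite eqn_leq ij.
Qed.

(** Strong induction on the length. If a nonzero shift [d] fixes [w], so does its gcd with [size w];
    this divides the length, so [w] is a power of a strictly shorter prefix. *)
Lemma aperiodic_root w : w != [::] ->
  exists v k, [/\ aperiodic v, (0 < k) & w = wpower v k].
Proof.
have [n] := ubnP (size w); elim: n w => // n IH w wn w0.
have [|/negP] := boolP (aperiodic w).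
  by exists w, 1%N; rewrite /wpower /= cats0.
move=> /negP; rewrite negb_and w0 /= -has_predC => /hasP[d].
rewrite mem_iota /= => /andP[d0].
have sw : (0 < size w) by rewrite lt0n size_eq0.
rewrite add1n prednK // => dw; rewrite negbK => /eqP wd.
pose g := gcdn d (size w).
have gw : (g %| size w) by exact: dvdn_gcdr.
have g0 : (0 < g) by rewrite gcdn_gt0 d0.
have gd : (g <= d) by rewrite dvdn_leq // dvdn_gcdl.
have wE : w = wpower (take g w) (size w %/ g).
  by apply: rot_dvdn => //; apply: rot_gcdn => //; rewrite ?rot_size ?(ltnW dw).
have gltw := leq_ltn_trans gd dw.
have [||v [k [av k0 tE]]] := IH (take g w).
- by rewrite size_takel ?(ltnW gltw) // (leq_trans gltw).
- by rewrite -size_eq0 size_takel ?(ltnW gltw) // -lt0n.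
have km l : wpower (wpower v k) l = wpower v (l * k).
  by elim: l => // l IHl; rewrite wpowerS IHl mulSn /wpower nseqD flatten_cat.
exists v, (size w %/ g * k); split => //; last by rewrite -km -tE.
by rewrite muln_gt0 k0 divn_gt0 // dvdn_leq.
Qed.

Lemma wpower_rot v k : (0 < k) -> rot (size v) (wpower v k) = wpower v k.
Proof. by move=> k0; rewrite rot_wpower // rot_size. Qed.

Lemma take_wpower v k : (0 < k) -> take (size v) (wpower v k) = v.
Proof. by case: k => // k _; rewrite wpowerS take_size_cat. Qed.

(** Both base lengths are periods of the common word, hence so is their gcd. It divides each base
    length, so aperiodicity forces both lengths to equal it, and both bases are the prefix of that
    length. *)
Lemma wpower_aperiodic_inj v x k l : aperiodic v -> aperiodic x ->
  (0 < k) -> (0 < l) -> wpower v k = wpower x l -> v = x.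
Proof.
move=> av ax k0 l0 vx.
set w := wpower v k in vx; pose g := gcdn (size v) (size x).
have [v0 _] := aperiodicP _ av; have [x0 _] := aperiodicP _ ax.
have vw : (size v <= size w) by rewrite size_wpower leq_pmull.
have xw : (size x <= size w) by rewrite vx size_wpower leq_pmull.
have wg : rot g w = w.
  by apply: rot_gcdn; rewrite // ?vx ?wpower_rot // -vx wpower_rot.
have g0 : (0 < g) by rewrite gcdn_gt0 v0.
have root y m : aperiodic y -> (0 < m) -> w = wpower y m ->
    (g %| size y) -> size y = g.
  move=> /aperiodicP[y0 Hy] m0 wE gy.
  have gley : (g <= size y) by rewrite dvdn_leq.
  apply/eqP; rewrite eqn_leq gley andbT leqNgt; apply/negP => gly.
  have : rot g y = y.
    have := wg; rewrite wE rot_wpower // => /(congr1 (take (size y))).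
    by rewrite take_wpower // -{1}(size_rot g y) take_wpower.
  by move/(Hy _ gly) => gE; rewrite gE in g0.
have sv : size v = g by apply: root k0 _ _ => //; exact: dvdn_gcdl.
have sx : size x = g by apply: root l0 _ _ => //; exact: dvdn_gcdr.
by rewrite -(take_wpower v k k0) -/w vx sv -sx take_wpower.
Qed.

Lemma cycle_wpower (e : rel T) v k : (0 < k) ->
  path.cycle e (wpower v k) = path.cycle e v.
Proof.
case: v => [|a v]; first by move=> _; elim: k.
case: k => // k _; rewrite wpowerS /=; elim: k => [|k IH]; first by rewrite cats0.
rewrite wpowerS rcons_cat cat_path /= IH rcons_path.
by case: (path e a v); case: (e _ a).
Qed.

End Words.

(** * Counting closed paths by primes *)

Section Primes.
Variable X : graph_of_groups.
Implicit Types (P w : seq (step X)) (p q : prime_of X).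

Definition transition : rel (step X) :=
  [rel s t | consecutive s t && no_backtrack s t].

(** Not being a proper power amounts to having no rotational symmetry: the root given by
    [aperiodic_root] is itself closed, because [cycle] cannot tell a power from its base. *)
Lemma primitiveP P : primitive_path P <-> path.cycle transition P /\ aperiodic P.
Proof.
rewrite /transition cycle_relI; split.
  case=> /andP[P0 cP] rP nP; split; first by rewrite cP.
  have [v [k [av k0 PE]]] := aperiodic_root _ P0.
  case: (ltngtP k 1) => [|k1|k1]; first by rewrite ltnNge k0.
    case: nP; exists v, k; split=> //; apply/andP; split.
      by case/andP: av.
    by rewrite -(cycle_wpower _ _ _ k0) -PE.
  by rewrite PE k1 /wpower /= cats0.
case=> /andP[cP rP] /[dup] /andP[P0 _] /aperiodicP[s0 aP].
split=> //; first by apply/andP.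
case=> R [k [/andP[R0 cR] k2]]; rewrite -[path_power R k]/(wpower R k) => PE.
have sR : (0 < size R)%N by rewrite lt0n size_eq0.
have k0 : (0 < k)%N by exact: leq_trans k2.
have : size R = 0%N; last by move=> R0'; rewrite R0' in sR.
apply: aP; last by rewrite PE; exact: wpower_rot.
by rewrite PE size_wpower ltn_Pmull.
Qed.

(** The default [[::]] is never returned, since every class is inhabited; the body matches that of
    [prime_length], so lengths agree by conversion. *)
Definition representative p : seq (step X) := xget [::] (set_val p).

Lemma cyclic_equiv_rot P P' : P != [::] ->
  cyclic_equiv P P' <-> exists i, P' = rot i P.
Proof.
move=> P0; split=> [[i _ ->]|[i ->]]; first by exists i.
have [iP|Pi] := ltnP i (size P); first by exists i.
exists 0%N; first by rewrite lt0n size_eq0.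
by rewrite rot0 rot_oversize.
Qed.

Lemma cyclic_equiv_class P P' : P != [::] -> cyclic_equiv P P' ->
  path_class P' = path_class P.
Proof.
move=> P0 [i iP ->].
have P'0 : rot i P != [::] by rewrite -size_eq0 size_rot size_eq0.
apply/seteqP; split=> w; rewrite /path_class /= !cyclic_equiv_rot // => -[j ->].
  by exists (rot_add P i j); rewrite rot_rot_add.
exists (rot_add (rot i P) (size P - i) j).
by rewrite -rot_rot_add -(size_rot i P) [rot (_ - _) _]rotK.
Qed.

Lemma representativeP p : [/\ path.cycle transition (representative p),
  aperiodic (representative p) & set_val p = path_class (representative p)].
Proof.
have [P primP pE] : @primes_of X (set_val p) by exact: set_valP.
have [_ aP] := (primitiveP P).1 primP.
have P0 : P != [::] by case/andP: aP.
have rP : cyclic_equiv P (representative p).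
  rewrite -[cyclic_equiv P _]/(path_class P _) pE; apply: xgetPex.
  rewrite -pE; exists P; exists 0%N; rewrite ?rot0 //.
  by rewrite lt0n size_eq0.
rewrite -pE -(cyclic_equiv_class _ _ P0 rP).
case: rP => i _ ->; split=> //.
  by rewrite rot_cycle; case: ((primitiveP P).1 primP).
by rewrite aperiodic_rot.
Qed.

Lemma prime_lengthE p : prime_length p = size (representative p).
Proof. by []. Qed.

Lemma prime_length_gt0 p : (0 < prime_length p)%N.
Proof. by case: (representativeP p) => _ /aperiodicP[]. Qed.

Lemma representative_rot_inj p q i : representative p = rot i (representative q) ->
  p = q.
Proof.
have [_ _ pE] := representativeP p; have [_ aq qE] := representativeP q.
move=> pq; apply: val_inj; rewrite -!set_valE pE qE.
have q0 : representative q != [::] by case/andP: aq.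
by apply: cyclic_equiv_class => //; apply/cyclic_equiv_rot => //; exists i.
Qed.

Lemma representative_inj : injective representative.
Proof. by move=> p q pq; apply: (@representative_rot_inj p q 0); rewrite rot0. Qed.

Lemma representative_exists P : path.cycle transition P -> aperiodic P ->
  exists p i, [/\ prime_length p = size P, (i < prime_length p)%N &
                  P = rot i (representative p)].
Proof.
move=> cP aP; have primP : primitive_path P by apply/primitiveP.
have cl : path_class P \in @primes_of X by apply/mem_set; exists P.
pose p : prime_of X := SigSub cl.
have [_ ap pE] := representativeP p.
have p0 : representative p != [::] by case/andP: ap.
have : path_class (representative p) P.
  rewrite -pE; change (path_class P P); exists 0%N; rewrite ?rot0 //.
  by rewrite lt0n size_eq0; case/andP: aP.
by case=> i ip PE; exists p, i; split=> //; rewrite PE size_rot.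
Qed.

(** Representatives embed these primes into the bounded words over a finite alphabet. *)
Lemma finite_short_primes N : finite_set [set p : prime_of X | (prime_length p <= N)%N].
Proof.
rewrite -(eq_finite_set (inj_card_eq (f := representative) _)); last first.
  by move=> p q _ _; exact: representative_inj.
apply: (@sub_finite_set _ _ [set val b | b in [set: N.-bseq (step X)]]).
  by move=> _ [p /= pN <-]; exists (Bseq pN).
exact/finite_image/finite_finset.
Qed.

(* A closed word of length [j] is uniquely a rotation of a power of a prime. *)
Lemma card_closed_words (F : {fset prime_of X}) j : (0 < j)%N ->
  (forall p, (prime_length p <= j)%N -> p \in F) ->
  #|[pred w : j.-tuple (step X) | path.cycle transition w]| =
  (\sum_(p <- F | (prime_length p %| j)%N) prime_length p)%N.
Proof.
move=> j0 FP.
(* Rotation by [prime_length p] fixes the power, so only smaller shifts are listed; these give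
   distinct words. *)
pose L := [seq rot i (wpower (representative p) (j %/ prime_length p)) |
  p <- [seq p <- F | (prime_length p %| j)%N], i <- iota 0 (prime_length p)].
pose M := [seq val t | t <-
  enum [pred w : j.-tuple (step X) | path.cycle transition w]].
have jp p : (prime_length p %| j)%N -> (0 < j %/ prime_length p)%N.
  by move=> pj; rewrite divn_gt0 ?prime_length_gt0 // dvdn_leq.
suff : perm_eq L M.
  move=> /perm_size; rewrite size_map -cardE => <-.
  rewrite size_allpairs_dep sumnE big_map big_filter.
  by under eq_bigr do rewrite size_iota.
apply: uniq_perm.
- apply: allpairs_uniq_dep.
  + by rewrite filter_uniq // fset_uniq.
  + by move=> p _; exact: iota_uniq.
  move=> /= pi pi' /allpairsPdep[p [i [+ + ->]]] /allpairsPdep[q [k [+ + ->]]] /=.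
  rewrite !mem_filter !mem_iota /= !add0n => /andP[pj _] ip /andP[qj _] kq.
  have [_ ap _] := representativeP p; have [_ aq _] := representativeP q.
  rewrite rot_wpower ?jp 1?ltnW // rot_wpower ?jp 1?ltnW // => rE.
  have {}rE : rot i (representative p) = rot k (representative q).
    by apply: wpower_aperiodic_inj rE; rewrite ?aperiodic_rot ?jp.
  have pq : p = q.
    apply: (@representative_rot_inj p q (rot_add (representative q) k (prime_length p - i))).
    rewrite -rot_rot_add -rE prime_lengthE -(size_rot i (representative p)).
    by rewrite [RHS]rotK.
  move: ip pj ap rE; rewrite pq => ip _ ap rE.
  by rewrite (rot_aperiodic_inj _ _ _ aq ip kq rE).
- by rewrite map_inj_uniq ?enum_uniq //; exact: val_inj.
move=> w; apply/allpairsPdep/mapP => /=.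
  case=> p [i []]; rewrite mem_filter mem_iota /= add0n => /andP[pj _] ip wE.
  have [cp _ _] := representativeP p.
  have sw : size w == j by rewrite wE size_rot size_wpower divnK.
  exists (Tuple sw) => //; rewrite mem_enum inE /= wE rot_cycle cycle_wpower //.
  exact: jp.
case=> t; rewrite mem_enum inE => ct ->.
have t0 : val t != [::] by rewrite -size_eq0 size_tuple -lt0n.
have [v [k [av k0 tE]]] := aperiodic_root _ t0.
have cv : path.cycle transition v by rewrite -(cycle_wpower _ _ _ k0) -tE.
have [p [i [pv ip vE]]] := representative_exists v cv av.
have jE : j = (k * prime_length p)%N by rewrite pv -size_wpower -tE size_tuple.
have pj : (prime_length p %| j)%N by rewrite jE dvdn_mull.
have pF : p \in F by apply: FP; rewrite dvdn_leq.
exists p, i; rewrite mem_filter mem_iota /= add0n pj pF; split => //.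
have -> : (j %/ prime_length p = k)%N by rewrite jE mulnK // prime_length_gt0.
by rewrite rot_wpower ?(ltnW ip) // tE vE.
Qed.

End Primes.

(** * Determinants and traces *)

(** Both sides compute the determinant of the block matrix [[1, A; B, 1]], through its two block
    triangular factorizations. *)
Lemma det_1sub_mulmxC {R : comPzRingType} {m n} (A : 'M[R]_(m, n)) (B : 'M[R]_(n, m)) :
  \det (1%:M - A *m B) = \det (1%:M - B *m A).
Proof.
have E1 : block_mx 1%:M A B 1%:M =
    block_mx 1%:M 0 B 1%:M *m block_mx 1%:M A 0 (1%:M - B *m A).
  by rewrite mulmx_block !(mul1mx, mulmx1, mul0mx, mulmx0, addr0) addrC subrK.
have E2 : block_mx 1%:M A B 1%:M =
    block_mx (1%:M - A *m B) A 0 1%:M *m block_mx 1%:M 0 B 1%:M.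
  by rewrite mulmx_block !(mul1mx, mulmx1, mul0mx, mulmx0, addr0, add0r) subrK.
have := congr1 (fun M => \det M) (etrans (esym E1) E2) => /=.
by rewrite !det_mulmx !det_lblock !det_ublock !det1 !(mul1r, mulr1).
Qed.

Section TransferMatrix.
Context {R : pzRingType} {T : finType}.
Variable e : rel T.

Definition transfer_mx : 'M[R]_#|T| :=
  \matrix_(i, j) (e (enum_val i) (enum_val j))%:R.

Lemma big_cons_tuple (V : nmodType) n (F : n.+1.-tuple T -> V) :
  \sum_w F w = \sum_(x : T) \sum_(p : n.-tuple T) F [tuple of x :: p].
Proof.
rewrite pair_bigA /= (reindex (fun xp : T * n.-tuple T => [tuple of xp.1 :: xp.2])) //.
exists (fun w : n.+1.-tuple T => (thead w, [tuple of behead w])) => [[x p] _|w _] /=.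
  by rewrite theadE; congr pair; apply: val_inj.
by rewrite -tuple_eta.
Qed.

(** The entries of [p] are the [n] intermediate states of a walk with [n.+1] transitions. *)
Lemma transfer_mx_exp n i j : (transfer_mx ^+ n.+1) i j =
  \sum_(p : n.-tuple T) (path.path e (enum_val i) (rcons p (enum_val j)))%:R.
Proof.
elim: n i j => [|n IH] i j.
  rewrite expr1 mxE (bigD1 [tuple]) //= big1 ?addr0 ?andbT // => p /eqP[].
  exact: tuple0.
rewrite exprS -[_ * _]/(_ *m _) mxE big_cons_tuple.
rewrite (reindex (@enum_val T T)) /=; last by apply: onW_bij; exact: enum_val_bij.
apply: eq_bigr => k _; rewrite IH mulr_sumr; apply: eq_bigr => p _.
by rewrite mxE /= -natrM mulnb.
Qed.

Lemma tr_transfer_mx_exp n : \tr (transfer_mx ^+ n.+1) =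
  #|[pred w : n.+1.-tuple T | path.cycle e w]|%:R.
Proof.
rewrite -[in RHS]sum1_card natr_sum big_mkcond /= big_cons_tuple.
rewrite [RHS](reindex (@enum_val T T)) /=; last by apply: onW_bij; exact: enum_val_bij.
apply: eq_bigr => i _; rewrite transfer_mx_exp; apply: eq_bigr => p _.
by rewrite inE /=; case: ifP.
Qed.

End TransferMatrix.

Lemma is_trig_mxM {R : pzRingType} n (A B : 'M[R]_n) :
  is_trig_mx A -> is_trig_mx B ->
  is_trig_mx (A *m B) /\ forall i, (A *m B) i i = A i i * B i i.
Proof.
move=> /is_trig_mxP tA /is_trig_mxP tB; split.
  apply/is_trig_mxP => i j ij; rewrite mxE big1 // => k _.
  have [ik|ki] := ltnP i k; first by rewrite tA ?mul0r.
  by rewrite tB ?mulr0 // (leq_ltn_trans ki).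
move=> i; rewrite mxE (bigD1 i) //= big1 ?addr0 // => k ki.
case: (ltngtP i k) => [ik|ik|ik]; first by rewrite tA ?mul0r.
  by rewrite tB ?mulr0.
by rewrite (val_inj ik) eqxx in ki.
Qed.

Lemma is_trig_mx_exp {R : pzRingType} n (A : 'M[R]_n) k :
  is_trig_mx A -> is_trig_mx (A ^+ k) /\ forall i, (A ^+ k) i i = A i i ^+ k.
Proof.
move=> tA; elim: k => [|k [tAk dAk]].
  split=> [|i]; last by rewrite expr0 mxE eqxx.
  by apply/is_trig_mxP => i j ij; rewrite mxE -val_eqE /= ltn_eqF.
have [tM dM] := is_trig_mxM n A (A ^+ k) tA tAk; rewrite exprS; split=> // i.
by rewrite exprS -dAk; exact: dM.
Qed.

(** Schur triangularization: [lam] is the diagonal of a triangular conjugate of [M], and conjugation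
    changes neither determinants nor traces. *)
Lemma eigenvalues_det_tr {C : numClosedFieldType} n (M : 'M[C]_n) :
  exists lam : 'I_n -> C,
    (forall u, \det (1%:M - u *: M) = \prod_i (1 - u * lam i)) /\
    (forall k, \tr (M ^+ k) = \sum_i lam i ^+ k).
Proof.
have [P /spectral.unitarymx_unit Pu /andP[PM _]] := @spectral.cotrigonalization2 C n M M erefl.
have [T tT TE] : exists2 T, is_trig_mx T & T = P *m M *m invmx P.
  by exists (conjmx P M); [exact: PM|exact: conjumx].
have ME : M = invmx P *m T *m P by rewrite TE !mulmxA mulVmx // mul1mx -mulmxA mulVmx // mulmx1.
have MkE k : M ^+ k = invmx P *m T ^+ k *m P.
  elim: k => [|k IH]; first by rewrite !expr0 mulmx1 mulVmx.
  rewrite !exprS IH {1}ME -![_ * _]/(_ *m _) !mulmxA; congr (_ *m _ *m _).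
  by rewrite -[_ *m P *m _]mulmxA mulmxV // mulmx1.
exists (fun i => T i i); split=> [u|k].
  have -> : 1%:M - u *: M = invmx P *m (1%:M - u *: T) *m P.
    rewrite mulmxBr mulmxBl mulmx1 mulVmx // {1}ME.
    by rewrite -scalemxAr -scalemxAl.
  rewrite !det_mulmx mulrAC -det_mulmx mulVmx // det1 mul1r det_trig.
    by apply: eq_bigr => i _; rewrite !mxE eqxx.
  apply/is_trig_mxP => i j ij; rewrite !mxE -val_eqE /= ltn_eqF //.
  by move/is_trig_mxP: tT => ->; rewrite // mulr0 subr0.
rewrite MkE mxtrace_mulC mulmxA mulmxV // mul1mx.
by apply: eq_bigr => i _; case: (is_trig_mx_exp n T k tT) => _ ->.
Qed.

(* The involution splits into 2x2 blocks [1, u; u, 1] = [1, 0; u, 1][1, u; 0, 1 - u^2];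
   ordering each orbit by the index makes both factors triangular. *)
Lemma det_1add_involution {R : comPzRingType} n (f : 'I_n -> 'I_n) (u : R) :
  involutive f ->
  \det (1%:M + u *: \matrix_(i, j) (j == f i)%:R) =
  (1 - u ^+ 2) ^+ #|[set i | (f i < i)%N]%SET| * (1 + u) ^+ #|[set i | f i == i]%SET|.
Proof.
move=> fK.
pose L : 'M[R]_n := \matrix_(i, j) ((j == i)%:R + u * ((j == f i) && (f i < i)%N)%:R).
(* The weak inequality [i <= f i] puts the [u] of a fixed point on the diagonal, giving [1 + u]; a
   two-element orbit has its [1 - u ^+ 2] at its larger index. *)
pose U : 'M[R]_n := \matrix_(i, j) ((if (f i < i)%N then 1 - u ^+ 2 else 1) * (j == i)%:R
  + u * ((j == f i) && (i <= f i)%N)%:R).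
have LU : 1%:M + u *: \matrix_(i, j) (j == f i)%:R = L *m U.
  apply/matrixP => i k; rewrite !mxE.
  under eq_bigr => j _ do rewrite mxE mulrDl.
  rewrite big_split /= (bigD1 i) //= eqxx mul1r big1 ?addr0; last first.
    by move=> j /negPf ->; rewrite mul0r.
  rewrite (bigD1 (f i)) //= eqxx /= [X in _ + (_ + X)]big1 ?addr0; last first.
    by move=> j /negPf ->; rewrite mulr0 mul0r.
  rewrite !mxE fK [i == k]eq_sym.
  case: (ltngtP (f i) i) => fi; rewrite /= ?mul1r ?mulr1 ?mulr0 ?mul0r ?addr0 ?andbT ?andbF //.
  by rewrite mulr0n; move: (k == i)%:R (k == f i)%:R => a b; ring.
have dL : \det L = 1.
  rewrite det_trig.
    apply: big1 => i _; rewrite !mxE eqxx -val_eqE.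
    by case: ltngtP; rewrite ?mulr0 addr0.
  apply/is_trig_mxP => i j ij; rewrite !mxE -val_eqE gtn_eqF // add0r.
  by case: (j =P f i) => [<-|_]; rewrite ?ltnNge ?(ltnW ij) mulr0.
have dU : \det U = \prod_i ((if (f i < i)%N then 1 - u ^+ 2 else 1) *
                           (if f i == i then 1 + u else 1)).
  rewrite -det_tr det_trig.
    apply: eq_bigr => i _; rewrite !mxE eqxx mulr1 [i == f i]eq_sym -val_eqE.
    by case: ltngtP; rewrite /= ?mulr0 ?mulr1 ?addr0 ?mul1r.
  apply/is_trig_mxP => i j ij; rewrite !mxE -val_eqE ltn_eqF // mulr0 add0r.
  by case: (i =P f j) => [<-|_]; rewrite 1?leqNgt ?ij mulr0.
rewrite LU det_mulmx dL mul1r dU big_split /= -!big_mkcond /= !prodr_const.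
by congr (_ ^+ _ * _ ^+ _); apply: eq_card => i; rewrite !inE.
Qed.

(** * The determinant identity on the graph *)

Lemma sum_enum_val {V : nmodType} {T : finType} (F : T -> V) :
  \sum_(i < #|T|) F (enum_val i) = \sum_x F x.
Proof. by rewrite [RHS](reindex (@enum_val T T)) //; apply/onW_bij/enum_val_bij. Qed.

Lemma sum_tagged {V : nmodType} {I : finType} {J : I -> finType}
    (F : forall i, J i -> V) :
  \sum_(t : {i : I & J i}) F (tag t) (tagged t) = \sum_i \sum_(j : J i) F i j.
Proof. by rewrite sig_big_dep. Qed.

Lemma sum_natr_eq {V : pzSemiRingType} {T : finType} (x : T) (F : T -> V) :
  \sum_y F y * (y == x)%:R = F x.
Proof.
by rewrite (bigD1 x) //= eqxx mulr1 big1 ?addr0 // => y /negPf->; rewrite mulr0.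
Qed.

Section GraphMatrices.
Variables (K : fieldType) (X : graph_of_groups).

Local Notation nH := #|half_edge X|.
Local Notation nV := (nb_vertices X).

Definition bar_ord (i : 'I_nH) : 'I_nH := enum_rank (hbar (enum_val i)).

Lemma bar_ordK : involutive bar_ord.
Proof. by move=> i; rewrite /bar_ord enum_rankK hbarK enum_valK. Qed.

Lemma card_legs : #|[set i | bar_ord i == i]%SET| = #|legs X|.
Proof.
rewrite -(card_imset _ enum_val_inj); apply: eq_card => h.
apply/imsetP/idP => [[i + ->]|]; rewrite !inE.
  by rewrite /bar_ord => /eqP {2}<-; rewrite enum_rankK.
move=> hh; exists (enum_rank h); last by rewrite enum_rankK.
by rewrite inE /bar_ord enum_rankK (eqP hh).
Qed.

(** Each edge is counted at its half-edge of larger rank; the strict inequality leaves out the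
    legs. *)
Lemma card_edges : #|[set i | (bar_ord i < i)%N]%SET| = #|edges X|.
Proof.
pose orbit (i : 'I_nH) := [set enum_val i; hbar (enum_val i)]%SET.
have barE i : hbar (enum_val i) = enum_val (bar_ord i) by rewrite /bar_ord enum_rankK.
have inj : {in [set i | (bar_ord i < i)%N]%SET &, injective orbit}.
  move=> i j; rewrite !inE => ii jj /setP/(_ (enum_val i)).
  rewrite !inE eqxx /= !barE => /esym /orP[] /eqP/enum_val_inj // ij.
  by move: ii; rewrite ij bar_ordK ltnNge (ltnW jj).
rewrite -(card_in_imset inj); apply: eq_card => E.
apply/imsetP/imsetP => -[].
  move=> i; rewrite inE => ii ->; exists (enum_val i) => //; rewrite inE barE.
  by apply/eqP => /enum_val_inj /(congr1 val) /= ij; rewrite ij ltnn in ii.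
move=> h; rewrite inE => hh ->; set i := enum_rank h.
have hE : h = enum_val i by rewrite enum_rankK.
rewrite hE in hh *.
case: (ltngtP (bar_ord i) i) => ii.
- by exists i; rewrite ?inE.
- exists (bar_ord i); first by rewrite inE bar_ordK.
  by rewrite /orbit barE -barE hbarK barE finset.setUC.
- by rewrite barE (val_inj ii) eqxx in hh.
Qed.

(** Whether [t] may follow [s] depends on [s] only through its half-edge, so the transition matrix
    factors through half-edges, as [tail_mx] times [follow_mx]. *)
Definition tail_mx : 'M[K]_(#|step X|, nH) :=
  \matrix_(s, h) (step_edge (enum_val s) == enum_val h)%:R.

Definition follow_mx : 'M[K]_(nH, #|step X|) :=
  \matrix_(h, t) ((vroot (step_edge (enum_val t)) == vroot (hbar (enum_val h))) &&
    ((step_edge (enum_val t) != hbar (enum_val h)) || (step_elt (enum_val t) != 1%g)))%:R.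

Definition target_mx : 'M[K]_(nH, nV) :=
  \matrix_(h, v) (vroot (hbar (enum_val h)) == vertex_at v)%:R.

Definition root_mx : 'M[K]_(nV, nH) :=
  \matrix_(v, h) (vroot (enum_val h) == vertex_at v)%:R.

Definition bar_mx : 'M[K]_nH := \matrix_(i, j) (j == bar_ord i)%:R.

Lemma transfer_mxE : transfer_mx (transition X) = tail_mx *m follow_mx.
Proof.
apply/matrixP => s t; rewrite !mxE.
under eq_bigr => h _ do rewrite !mxE mulrC [_ == enum_val h]eq_sym.
pose F h : K := ((vroot (step_edge (enum_val t)) == vroot (hbar h)) &&
    ((step_edge (enum_val t) != hbar h) || (step_elt (enum_val t) != 1%g)))%:R.
rewrite (sum_enum_val (fun h => F h * (h == step_edge (enum_val s))%:R)).
by rewrite sum_natr_eq.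
Qed.

(** The entry at [h], [k] counts the [g] for which the step [(k, g)] may follow [h]. If [k] starts
    where [h] ends, the whole group is allowed, except that [k = hbar h] forbids [g = 1]; this loss
    is [bar_mx]. *)
Lemma follow_tail_mxE : follow_mx *m tail_mx =
  target_mx *m (charge_mx K X *m root_mx) - bar_mx.
Proof.
apply/matrixP => i j; rewrite mul_diag_mx !mxE.
set h := enum_val i; set k := enum_val j.
transitivity (\sum_(g : vgroup (vroot k)) ((vroot k == vroot (hbar h)) &&
    ((k != hbar h) || (g != 1%g)))%:R : K).
  under eq_bigr => t _ do rewrite !mxE.
  pose F e (g : vgroup (vroot e)) : K := ((vroot e == vroot (hbar h)) &&
    ((e != hbar h) || (g != 1%g)))%:R * (e == k)%:R.
  rewrite (sum_enum_val (fun t : step X => F (tag t) (tagged t))) sum_tagged.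
  by under eq_bigr => e _ do rewrite /F -mulr_suml; rewrite sum_natr_eq.
under [in RHS]eq_bigr => v _ do rewrite !mxE.
transitivity ((vroot (hbar h) == vroot k)%:R * #|vgroup (vroot k)|%:R - (j == bar_ord i)%:R : K).
  have -> : (j == bar_ord i) = (k == hbar h).
    by rewrite -(inj_eq enum_val_inj) /bar_ord enum_rankK.
  have [kh|kh] := eqVneq k (hbar h).
    rewrite kh eqxx mul1r /=.
    rewrite (bigD1 1%g) //= eqxx add0r.
    rewrite (eq_bigr (fun=> 1)) => [|g ->//].
    rewrite sumr_const cardC1 -natrB ?card_gt0 //.
      by rewrite subn1.
    by apply/card_gt0P; exists 1%g.
  by rewrite subr0 eq_sym; case: eqP => _; rewrite /= ?mul1r ?mul0r sumr_const ?mul0rn.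
congr (_ - _); rewrite [RHS](reindex enum_rank); last exact/onW_bij/enum_rank_bij.
under eq_bigr => v _ do rewrite /vertex_at enum_rankK mulrA [vroot k == v]eq_sym.
by rewrite sum_natr_eq.
Qed.

Lemma root_target_mxE : root_mx *m target_mx = adjacency_mx K X.
Proof.
apply/matrixP => x y; rewrite !mxE.
under eq_bigr => h _ do rewrite !mxE -natrM mulnb.
rewrite (sum_enum_val (fun h => ((vroot h == vertex_at x) && (vroot (hbar h) == vertex_at y))%:R)).
rewrite -sum1_card natr_sum [RHS]big_mkcond /=.
by apply: eq_bigr => h _; rewrite inE; case: (_ && _).
Qed.

(** The target of [hbar h] is the root of [h], so an entry counts half-edges rooted at both
    vertices. *)
Lemma root_bar_target_mxE : root_mx *m bar_mx *m target_mx = valency_mx K X.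
Proof.
have -> : root_mx *m bar_mx *m target_mx =
    \matrix_(x, y) \sum_(h : half_edge X) ((vroot h == vertex_at x) && (vroot h == vertex_at y))%:R.
  rewrite -mulmxA; apply/matrixP => x y; rewrite !mxE.
  rewrite -[RHS]sum_enum_val; apply: eq_bigr => h _; rewrite !mxE -mulnb natrM; congr (_ * _).
  under eq_bigr => j _ do rewrite !mxE mulrC.
  rewrite (sum_natr_eq (bar_ord h) (fun j => (vroot (hbar (enum_val j)) == vertex_at y)%:R)).
  by rewrite /bar_ord enum_rankK hbarK.
apply/matrixP => x y; rewrite !mxE; have [->|xy] := eqVneq x y.
  rewrite mulr1n /valency -sum1_card natr_sum [RHS]big_mkcond /=.
  by apply: eq_bigr => h _; rewrite inE andbb; case: (_ == _).
rewrite mulr0n big1 // => h _; case: eqP => //= ->.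
by rewrite (inj_eq enum_val_inj) (negPf xy).
Qed.

(** Once on half-edges, [M = 1 + u J] is factored out, with explicit inverse because [J] squares to
    the identity; the other factor is the identity minus a product through the vertices, so a second
    exchange applies. *)
Lemma det_transfer_mx (u : K) : 1 - u ^+ 2 != 0 ->
  \det (1%:M - u *: transfer_mx (transition X)) =
  (1 - u ^+ 2) ^ (betti1 X - 1) * (1 + u) ^+ #|legs X| *
  \det (1%:M - u *: (charge_mx K X *m adjacency_mx K X)
        + u ^+ 2 *: (charge_mx K X *m valency_mx K X - 1%:M)).
Proof.
set a := 1 - u ^+ 2 => a0; set C := charge_mx K X.
have JJ : bar_mx *m bar_mx = 1%:M.
  apply/matrixP => i j; rewrite !mxE.
  under eq_bigr => k _ do rewrite !mxE mulrC.
  by rewrite (sum_natr_eq (bar_ord i) (fun k => (j == bar_ord k)%:R)) bar_ordK eq_sym.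
set M := 1%:M + u *: bar_mx; set M' := 1%:M - u *: bar_mx.
have MM' : M *m (a^-1 *: M') = 1%:M.
  rewrite -scalemxAr mulmxDl mul1mx mulmxBr mulmx1 -scalemxAl -scalemxAr JJ.
  rewrite scalerA -expr2 addrA subrK.
  by rewrite -[1%:M in X in X - _]scale1r -scalerBl scalerA mulVf // scale1r.
rewrite transfer_mxE scalemxAr det_1sub_mulmxC -scalemxAl follow_tail_mxE.
have -> : 1%:M - u *: (target_mx *m (C *m root_mx) - bar_mx) =
    M *m (1%:M - (a^-1 *: M') *m (u *: target_mx) *m (C *m root_mx)).
  rewrite mulmxBr mulmx1 !mulmxA MM' mul1mx scalerBr -scalemxAl -scalemxAl -!mulmxA.
  by rewrite opprB addrA addrAC.
rewrite det_mulmx det_1sub_mulmxC /M det_1add_involution; last exact: bar_ordK.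
rewrite card_edges card_legs.
(* In [M' = 1 - u J], the identity yields the adjacency matrix and [J] the valency matrix; the
   [- u ^+ 2] on the identity comes from factoring out [a^-1]. *)
have -> : 1%:M - C *m root_mx *m (a^-1 *: M' *m (u *: target_mx)) =
    a^-1 *: (1%:M - u *: (C *m adjacency_mx K X) + u ^+ 2 *: (C *m valency_mx K X - 1%:M)).
  rewrite -root_target_mxE -root_bar_target_mxE.
  rewrite -scalemxAl -scalemxAr -scalemxAr -scalemxAr -!mulmxA.
  rewrite mulmxBl mul1mx -scalemxAl !mulmxBr -!scalemxAr.
  set E := C *m (root_mx *m target_mx).
  set G := C *m (root_mx *m (bar_mx *m target_mx)).
  apply: (scalerI a0); rewrite scalerBr !scalerA mulfV // mulVKf // !scale1r.
  rewrite scalerBr !scalerBr scalerA -expr2 /a scalerBl scale1r.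
  move: (_ *: E) (_ *: G) (u ^+ 2 *: 1%:M) => e g w.
  by rewrite opprB [g - e]addrC addrACA [- w + g]addrC.
(* The scalar contributes [a^-1] once per vertex, which makes the exponent of [a] the integer
   [betti1 X - 1], edges minus vertices, possibly negative. *)
rewrite detZ /betti1 addrK expfzDr // -exprz_inv -!exprnP.
by rewrite !mulrA; congr (_ * _); rewrite mulrAC.
Qed.

End GraphMatrices.

(** * Polynomials determined by their logarithmic derivative *)

Section LogDerivative.
Context {K : numDomainType}.
Implicit Types (p q : {poly K}) (t s : nat -> K) (N : nat).

(* [p] satisfies [- X p' / p = \sum_(j >= 1) t j X^j] modulo [X^(N+1)]. *)
Definition log_deriv N t p : Prop := forall k, (k <= N)%N ->
  ('X * p^`() + p * \poly_(j < N.+1) (t j *+ (j != 0)%N))`_k = 0.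

Lemma eq_log_deriv N t s p : (forall j, (0 < j <= N)%N -> t j = s j) ->
  log_deriv N t p -> log_deriv N s p.
Proof.
move=> ts tp k kN; rewrite -[RHS](tp k kN).
suff -> : \poly_(j < N.+1) (s j *+ (j != 0)%N) = \poly_(j < N.+1) (t j *+ (j != 0)%N).
  by [].
apply/polyP => j; rewrite !coef_poly ltnS; case: leqP => // jN.
by case: j jN => // j jN; rewrite ts.
Qed.

Lemma log_derivB N t p q : log_deriv N t p -> log_deriv N t q ->
  log_deriv N t (p - q).
Proof.
move=> tp tq k kN; rewrite derivB mulrBr mulrBl addrACA -opprD coefB.
by rewrite tp // tq // subrr.
Qed.

(** By the Leibniz rule, the defect of [p * q] is [q] times the defect of [p] plus [p] times that of
    [q]. *)
Lemma log_derivM N t s p q : log_deriv N t p -> log_deriv N s q ->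
  log_deriv N (fun j => t j + s j) (p * q).
Proof.
rewrite /log_deriv; set P := \poly_(j < _) (t j *+ _); set Q := \poly_(j < _) (s j *+ _).
move=> tp sq k kN.
have -> : \poly_(j < N.+1) ((t j + s j) *+ (j != 0)%N) = P + Q.
  by apply/polyP => j; rewrite coefD !coef_poly; case: ifP; rewrite ?addr0 // mulrnDl.
rewrite derivM.
have -> : 'X * (p^`() * q + p * q^`()) + p * q * (P + Q) =
    q * ('X * p^`() + p * P) + p * ('X * q^`() + q * Q) by ring.
rewrite coefD !coefM !big1 ?addr0 // => i _; rewrite ?tp ?sq ?mulr0 //;
  exact: leq_trans (leq_subr _ _) kN.
Qed.

Lemma log_deriv_prod N (I : Type) (r : seq I) (F : I -> {poly K}) (T : I -> nat -> K) :
  (forall i, log_deriv N (T i) (F i)) ->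
  log_deriv N (fun j => \sum_(i <- r) T i j) (\prod_(i <- r) F i).
Proof.
move=> TF; elim: r => [|i r IH].
  rewrite big_nil => k kN; rewrite derivC mulr0 add0r mul1r coef_poly big_nil.
  by case: ifP => // _; rewrite mul0rn.
rewrite big_cons; apply: eq_log_deriv (log_derivM _ _ _ _ _ (TF i) IH).
by move=> j _; rewrite big_cons.
Qed.

(** This is the geometric expansion of [l c X^l / (1 - c X^l)], checked coefficientwise: beyond
    degree [l], the contributions at [k] and [k - l] cancel. *)
Lemma log_deriv_binomial N l (c : K) : (0 < l)%N ->
  log_deriv N (fun j => (l%:R * c ^+ (j %/ l)) *+ (l %| j)%N) (1 - c *: 'X^l).
Proof.
move=> l0 k kN; set T := \poly_(j < _) _.
rewrite derivB derivC sub0r derivZ derivXn mulrN mulrBl mul1r.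
rewrite -scalerAr -scalerAl mulrnAr -exprS prednK //.
rewrite coefD coefN coefB !coefZ coefXnM coefMn coefXn.
have TE j : (j <= N)%N -> T`_j = (l%:R * c ^+ (j %/ l)) *+ (l %| j)%N *+ (j != 0)%N.
  by move=> jN; rewrite coef_poly ltnS jN.
rewrite TE // TE ?(leq_trans (leq_subr _ _)) //.
have [kl|lk|->] := ltngtP k l.
- rewrite [false%:R]mulr0n mul0rn !mulr0 !oppr0 add0r addr0.
  case: k kl {kN} => [|k] kl; first by rewrite mulr0n.
  by rewrite gtnNdvd.
- rewrite [false%:R]mulr0n mul0rn mulr0 oppr0 add0r subn_eq0 leqNgt lk.
  rewrite -lt0n (ltn_trans l0 lk) !mulr1n.
  have -> : (k %/ l = ((k - l) %/ l).+1)%N.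
    by rewrite -{1}(subnK (ltnW lk)) divnDr // divnn l0 addn1.
  rewrite dvdn_subl ?(ltnW lk) //.
  case: (l %| k)%N; last by rewrite !mulr0n mulr0 subr0.
  by rewrite !mulr1n exprS mulrCA subrr.
by rewrite subnn mulr0n mulr0 subr0 divnn dvdnn -lt0n l0 !mulr1n expr1 mulrC addNr.
Qed.

(** The condition is linear, so the difference [d] satisfies it; it expresses [k] times the
    coefficient of degree [k] by lower ones, and [k] cancels in characteristic zero. *)
Lemma log_deriv_inj N t p q : log_deriv N t p -> log_deriv N t q ->
  p`_0 = q`_0 -> forall k, (k <= N)%N -> p`_k = q`_k.
Proof.
move=> tp tq pq0; have := log_derivB _ _ _ _ tp tq.
set d := p - q => td k; have d0 : d`_0 = 0 by rewrite coefB pq0 subrr.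
suff dk : (k <= N)%N -> d`_k = 0.
  by move=> /dk /eqP; rewrite coefB subr_eq0 => /eqP.
elim/ltn_ind: k => -[//|k] IH kN; have := td _ kN.
(* The top convolution term vanishes because the series has no constant term. *)
rewrite coefD coefXM coef_deriv coefM big_ord_recr /= subnn coef_poly /= mulr0.
rewrite addr0 big1 ?addr0 => [|i _]; last first.
  by rewrite IH ?mul0r // (leq_trans (ltnW (ltn_ord i))).
by move/eqP; rewrite -mulr_natr mulf_eq0 pnatr_eq0 orbF => /eqP.
Qed.

End LogDerivative.

(** * Coefficientwise domination and numerical bounds *)

Section Domination.
Context {K : numFieldType}.
Implicit Types (f g p q : {poly K}).

(** The inequality makes the coefficients of [g] nonnegative, whence its compatibility with
    products. *)
Definition dominated f g : Prop := forall k, `|f`_k| <= g`_k.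

Lemma dominatedM f g p q : dominated f g -> dominated p q -> dominated (f * p) (g * q).
Proof.
move=> fg pq k; rewrite !coefM (le_trans (ler_norm_sum _ _ _)) //.
by apply: ler_sum => i _; rewrite normrM ler_pM.
Qed.

Lemma dominated_prod (I : Type) (r : seq I) (F G : I -> {poly K}) :
  (forall i, dominated (F i) (G i)) ->
  dominated (\prod_(i <- r) F i) (\prod_(i <- r) G i).
Proof.
move=> FG; elim: r => [|i r IH]; last by rewrite !big_cons; exact: dominatedM.
by rewrite !big_nil => k; rewrite coef1; case: eqP; rewrite ?normr1 ?normr0.
Qed.

Lemma dominated_binomial l : (0 < l)%N -> dominated (1 - 'X^l) (1 + 'X^l).
Proof.
move=> l0 k; rewrite coefB coefD coef1 coefXn; case: k => [|k].
  by rewrite (ltn_eqF l0) subr0 addr0 normr1.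
by rewrite sub0r add0r normrN; case: eqP; rewrite ?normr1 ?normr0.
Qed.

(** Only degrees [k > N] survive, and shrinking the radius by 4 gains [4^-k] in each. *)
Lemma dominated_tail f g N (rho u : K) : dominated f g ->
  (forall k, (k <= N)%N -> f`_k = 0) -> 0 <= rho -> `|u| <= rho / 4 ->
  `|f.[u]| <= 4^-1 ^+ N.+1 * g.[rho].
Proof.
move=> fg fN rho0 urho; pose n := maxn (size f) (size g).
rewrite (@horner_coef_wide _ n f) ?leq_maxl // (@horner_coef_wide _ n g) ?leq_maxr //.
rewrite mulr_sumr (le_trans (ler_norm_sum _ _ _)) //; apply: ler_sum => i _.
have gi : 0 <= g`_i by exact: le_trans (fg i).
have [iN|Ni] := leqP i N.
  by rewrite fN // mul0r normr0 !mulr_ge0 ?exprn_ge0 ?invr_ge0.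
rewrite normrM mulrCA ler_pM // normrX.
rewrite (le_trans (lerXn2r _ _ _ urho)) ?nnegrE ?divr_ge0 //.
rewrite exprMn mulrC ler_wpM2r ?exprn_ge0 //.
by apply: ler_wiXn2l; rewrite ?invr_ge0 // invf_le1 // ler1n.
Qed.

(** A new factor [1 + b] turns [1 - S] into [(1 + b) (1 - b - S) = 1 - S - b (S + b)], which is no
    larger. *)
Lemma prod_1add_le (I : Type) (r : seq I) (a : I -> K) : (forall i, 0 <= a i) ->
  (\prod_(i <- r) (1 + a i)) * (1 - \sum_(i <- r) a i) <= 1.
Proof.
move=> a0; have S0 r' : 0 <= \sum_(i <- r') a i by exact: sumr_ge0.
have P0 r' : 0 <= \prod_(i <- r') (1 + a i).
  by apply: prodr_ge0 => i _; rewrite addr_ge0.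
elim: r => [|i r IH]; first by rewrite !big_nil subr0 mulr1.
rewrite !big_cons; apply: le_trans IH; rewrite -mulrA mulrCA ler_wpM2l //.
rewrite -subr_ge0 (_ : _ - _ = a i * (\sum_(j <- r) a j + a i)); last by ring.
by rewrite mulr_ge0 ?addr_ge0.
Qed.

(** At most [#|T| ^ n] of the words have length [n], contributing at most [4^-n], and these add up
    to at most 1/3 over [n >= 1]. The successor keeps the base invertible for an empty alphabet. *)
Lemma sum_words_le {T : finType} (s : seq (seq T)) : uniq s -> [::] \notin s ->
  \sum_(w <- s) (4 * #|T|.+1%:R)^-1 ^+ size w <= 3^-1 :> K.
Proof.
move=> us s0; set rho := (_)^-1.
have rho0 : 0 <= rho by rewrite invr_ge0 mulr_ge0.
pose M := \max_(w <- s) size w.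
have -> : \sum_(w <- s) rho ^+ size w =
    \sum_(n < M) \sum_(w <- s | size w == n.+1) rho ^+ n.+1.
  under [RHS]eq_bigr do rewrite big_mkcond.
  rewrite exchange_big /= !(big_seq _ _ s); apply: eq_bigr => w ws.
  have w0 : (0 < size w)%N.
    by rewrite lt0n size_eq0; apply: contraNneq s0 => <-.
  have wM : ((size w).-1 < M)%N by rewrite prednK // leq_bigmax_seq.
  rewrite (bigD1 (Ordinal wM)) //= prednK // eqxx big1 ?addr0 // => i iw.
  case: eqP => // wi; case/eqP: iw; apply: val_inj; rewrite /= wi.
  by [].
have geo n : \sum_(i < n) (4^-1 : K) ^+ i.+1 = 3^-1 * (1 - 4^-1 ^+ n).
  elim: n => [|n IH]; first by rewrite big_ord0 subrr mulr0.
  by rewrite big_ord_recr /= IH exprS; field.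
apply: (@le_trans _ _ (\sum_(n < M) 4^-1 ^+ n.+1)); last first.
  by rewrite geo mulrBr mulr1 gerBl mulr_ge0 ?exprn_ge0 ?invr_ge0.
apply: ler_sum => n _; rewrite big_const_seq iter_addr_0.
have ct : (count (fun w => size w == n.+1) s <= #|T| ^ n.+1)%N.
  rewrite -size_filter -(card_tuple n.+1 T) cardE -(size_map val).
  apply: uniq_leq_size; first exact: filter_uniq.
  move=> w; rewrite mem_filter => /andP[sw _].
  by apply/mapP; exists (Tuple sw); rewrite ?mem_enum.
rewrite -[leLHS]mulr_natr; apply: (@le_trans _ _ (rho ^+ n.+1 * (#|T|.+1 ^ n.+1)%:R)).
  rewrite ler_wpM2l ?exprn_ge0 // ler_nat (leq_trans ct) // leq_exp2r //.
by rewrite natrX -exprMn /rho invfM mulrVK // unitfE pnatr_eq0.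
Qed.

End Domination.

(** * The limit of the Euler products *)

Section EulerProduct.
Variables (K : numFieldType) (X : graph_of_groups).
Implicit Types (F : {fset prime_of X}) (u : K).

Definition euler_poly F : {poly K} := \prod_(p <- F) (1 - 'X^(prime_length p)).

Definition euler_majorant F : {poly K} := \prod_(p <- F) (1 + 'X^(prime_length p)).

Lemma euler_partialE u F : euler_partial u F = ((euler_poly F).[u])^-1.
Proof.
rewrite /euler_partial prodfV /euler_poly horner_prod; congr (_^-1).
by apply: eq_bigr => p _; rewrite !hornerE.
Qed.

Definition short_primes N : {fset prime_of X} :=
  fset_set [set p : prime_of X | (prime_length p <= N)%N].

Lemma mem_short_primes N p : (prime_length p <= N)%N -> p \in short_primes N.
Proof.
move=> pN; rewrite in_fset_set; last exact: finite_short_primes.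
exact: mem_set.
Qed.

Lemma euler_poly_dominated F : dominated (euler_poly F) (euler_majorant F).
Proof.
by apply: dominated_prod => p; apply: dominated_binomial; exact: prime_length_gt0.
Qed.

Definition radius : K := (4 * #|step X|.+1%:R)^-1.

Lemma radius_gt0 : 0 < radius.
Proof. by rewrite invr_gt0 mulr_gt0. Qed.

(** Representatives are distinct nonempty words, so [sum_words_le] bounds the sum of the terms by
    1/3, and [1 / (1 - 1/3) = 3/2]. *)
Lemma euler_majorant_le F : (euler_majorant F).[radius] <= 3 / 2.
Proof.
have rho0 := ltW radius_gt0.
rewrite /euler_majorant horner_prod.
under eq_bigr do rewrite !hornerE.
set a := fun p : prime_of X => radius ^+ prime_length p.
have S3 : \sum_(p <- F) a p <= 3^-1.
  have := sum_words_le (K := K) [seq representative X p | p <- F].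
  rewrite big_map; apply.
    by rewrite map_inj_uniq ?fset_uniq //; exact: representative_inj.
  apply/mapP => -[p _ p0]; have := prime_length_gt0 X p.
  by rewrite prime_lengthE -p0.
have := prod_1add_le _ F a (fun p => exprn_ge0 _ rho0).
have P0 : 0 <= \prod_(p <- F) (1 + a p).
  by apply: prodr_ge0 => p _; rewrite addr_ge0 ?exprn_ge0.
move=> H; have : \prod_(p <- F) (1 + a p) * (1 - 3^-1) <= 1.
  by apply: le_trans H; rewrite ler_wpM2l // lerD2l lerN2.
have -> : 1 - 3^-1 = 2 / 3 :> K by field.
by rewrite -ler_pdivlMr ?divr_gt0 // invf_div mul1r.
Qed.

(** [D] is the coefficientwise limit of the Euler polynomials. *)
Variable D : {poly K}.
Hypothesis coefD : forall N F, (forall p, (prime_length p <= N)%N -> p \in F) ->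
  forall k, (k <= N)%N -> (euler_poly F)`_k = D`_k.

Lemma euler_poly_bound u : `|u| < radius / 4 -> D.[u] != 0 /\
  exists N0, forall N F, (N0 <= N)%N -> fsubset (short_primes N) F ->
    `|D.[u] - (euler_poly F).[u]| <= 4^-1 ^+ N.+1 * (3 / 2).
Proof.
move=> /ltW ur.
have rho0 := ltW radius_gt0.
have FS N F : fsubset (short_primes N) F ->
    forall p, (prime_length p <= N)%N -> p \in F.
  by move=> /fsubsetP FN p /mem_short_primes /FN.
(* [D] agrees with this Euler polynomial up to degree [size D] and vanishes beyond, so it inherits
   the majorant. *)
have D_dom : dominated D (euler_majorant (short_primes (size D))).
  move=> k; have [kD|Dk] := leqP k (size D).
    rewrite -(coefD _ _ (FS _ _ (fsubset_refl _)) _ kD).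
    exact: euler_poly_dominated.
  rewrite nth_default ?(ltnW Dk) // normr0.
  exact: le_trans (euler_poly_dominated _ _).
have D0 : D`_0 = 1.
  rewrite -(coefD 0%N _ (FS _ _ (fsubset_refl _)) 0%N isT) -horner_coef0 horner_prod.
  apply: big1 => p _; rewrite !hornerE expr0n gtn_eqF ?subr0 //.
  exact: prime_length_gt0.
have tail N f F : dominated f (euler_majorant F) ->
    (forall k, (k <= N)%N -> f`_k = 0) -> `|f.[u]| <= 4^-1 ^+ N.+1 * (3 / 2).
  move=> fF fN; apply: le_trans (dominated_tail _ _ _ _ _ fF fN rho0 ur) _.
  by rewrite ler_wpM2l ?exprn_ge0 ?invr_ge0 //; exact: euler_majorant_le.
split.
  (* [D - 1] has no constant term, so [D.[u]] is within 3/8 of 1. *)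
  have : `|(D - 1).[u]| <= 4^-1 ^+ 1 * (3 / 2).
    apply: (tail 0%N _ (short_primes (size D))) => k; last first.
      by rewrite leqn0 => /eqP->; rewrite coefB D0 coef1 subrr.
    rewrite coefB coef1; have [->|k0] := eqVneq k 0%N.
      by rewrite D0 subrr normr0; exact: le_trans (D_dom 0%N).
    by rewrite subr0; exact: D_dom.
  apply: contraTneq; rewrite hornerD hornerN -polyC1 hornerC => ->.
  rewrite sub0r normrN normr1 expr1.
  have -> : 4^-1 * (3 / 2) = 3 / 8 :> K by field.
  by rewrite ler_pdivlMr // mul1r ler_nat.
(* From [N >= size D] on, the difference is zero up to degree [N] and equals the Euler polynomial
   beyond. *)
exists (size D) => N F ND FN; rewrite distrC -hornerN -hornerD.
apply: (tail _ _ F) => k; last by move=> kN; rewrite coefB (coefD _ _ (FS _ _ FN) _ kN) subrr.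
rewrite coefB; have [kN|Nk] := leqP k N.
  rewrite (coefD _ _ (FS _ _ FN) _ kN) subrr normr0.
  exact: le_trans (euler_poly_dominated _ _).
rewrite [D`_k]nth_default ?subr0; first exact: euler_poly_dominated.
by rewrite (leq_trans ND) // ltnW.
Qed.

Lemma ihara_zeta_limit u : (forall e : K, 0 < e -> exists n, n.+1%:R^-1 < e) ->
  `|u| < radius / 4 -> zeta_converges X u /\ (ihara_zeta X u)^-1 = D.[u].
Proof.
move=> archi /euler_poly_bound[Du0 [N0 bd]].
have FF : ProperFilter (@summability.totally (prime_of X)).
  exact: summability.totally_filter.
have cvgE : (euler_poly F).[u] @[F --> summability.totally] --> D.[u].
  apply/cvgrPdist_lt => e e0; have [n ne] := archi e e0.
  exists (short_primes (maxn N0 n)) => // F /= FN.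
  apply: le_lt_trans (bd _ F (leq_maxl _ n) FN) _; apply: le_lt_trans ne.
  apply: (@le_trans _ _ (4^-1 ^+ n.+1 * (3 / 2))).
    rewrite ler_wpM2r ?divr_ge0 // ler_wiXn2l ?invr_ge0 ?invf_le1 ?ler1n //.
    by rewrite ltnS leq_maxr.
  (* Clearing denominators leaves [3 (n + 1) <= 2 . 4^(n + 1)], by induction. *)
  rewrite exprVn mulrC ler_pdivrMr ?exprn_gt0 // [leRHS]mulrC ler_pdivlMr ?ltr0Sn //.
  rewrite -natrX mulrAC ler_pdivrMr // -!natrM ler_nat.
  clear; elim: n => // n IH; rewrite expnS.
  by lia.
have cvgZ : @euler_partial K X u @ summability.totally --> D.[u]^-1.
  by rewrite (eq_cvg _ _ (euler_partialE u)); exact: cvgV.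
have zE : ihara_zeta X u = D.[u]^-1 by apply: cvg_lim.
split; last by rewrite zE invrK.
split; first by apply/cvg_ex; exists D.[u]^-1.
by rewrite zE invr_eq0.
Qed.

End EulerProduct.

(** Both polynomials are products of binomials; the logarithmic derivatives match because the sum of
    the [lam i ^+ j] is a trace, hence a count of closed words. *)
Lemma euler_polyE (K : numClosedFieldType) (X : graph_of_groups) : exists D : {poly K},
  (forall u, D.[u] = \det (1%:M - u *: transfer_mx (transition X))) /\
  (forall N (F : {fset prime_of X}), (forall p, (prime_length p <= N)%N -> p \in F) ->
     forall k, (k <= N)%N -> (euler_poly K X F)`_k = D`_k).
Proof.
have [lam [lam_det lam_tr]] := eigenvalues_det_tr _ (transfer_mx (R := K) (transition X)).
exists (\prod_i (1 - lam i *: 'X^1)); split=> [u|N F FN].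
  rewrite lam_det horner_prod; apply: eq_bigr => i _.
  by rewrite !hornerE mulrC.
apply: (log_deriv_inj N (fun j => \sum_i lam i ^+ j)).
- have -> : euler_poly K X F = \prod_(p <- F) (1 - 1 *: 'X^(prime_length p)).
    by apply: eq_bigr => p _; rewrite scale1r.
  apply: eq_log_deriv (log_deriv_prod _ _ _ _ _ (fun p =>
    log_deriv_binomial N _ 1 (prime_length_gt0 X p))).
  case=> // j jN; rewrite -lam_tr tr_transfer_mx_exp (card_closed_words X F) //.
    rewrite natr_sum [RHS]big_mkcond; apply: eq_bigr => p _.
    by rewrite expr1n mulr1; case: ifP.
  by move=> p pj; apply: FN; exact: leq_trans jN.
- apply: eq_log_deriv (log_deriv_prod _ _ _ _ _ (fun i =>
    log_deriv_binomial N 1 (lam i) isT)).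
  by move=> j _; apply: eq_bigr => i _; rewrite dvd1n divn1 mul1r mulr1n.
(* Equal constant terms are the initial condition that [log_deriv_inj] asks for. *)
have c0 l (c : K) : (0 < l)%N -> (1 - c *: 'X^l).[0] = 1.
  by move=> l0; rewrite !hornerE expr0n gtn_eqF // mulr0 subr0.
rewrite -!horner_coef0 !horner_prod !big1 // => [p _|p _]; first exact: c0.
by rewrite -['X^_]scale1r c0 // prime_length_gt0.
Qed.

Lemma complex_archimedean (R : realType) (e : R[i]) : 0 < e ->
  exists n, n.+1%:R^-1 < e.
Proof.
case: e => a b; rewrite ltcE /= => /andP[/eqP -> a0].
exists (Num.bound a^-1); rewrite -[_%:R](rmorph_nat (real_complex R)) -fmorphV ltcR.
rewrite invf_plt ?posrE // (lt_trans (archi_boundP _)) ?invr_ge0 ?ltW //.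
by rewrite ltr_nat.
Qed.

Theorem theorem3p7 (R : realType) (X : graph_of_groups)
    (Xconn : connected_graph X) :
  let n := nb_vertices X in
  let A : 'M[R[i]]_n := adjacency_mx R[i] X in
  let Q : 'M[R[i]]_n := valency_mx R[i] X in
  let C : 'M[R[i]]_n := charge_mx R[i] X in
  exists2 eps : R, 0 < eps &
    forall u : R[i], `|u| < eps%:C ->
      zeta_converges X u /\
      (ihara_zeta X u)^-1 =
        (1 - u ^+ 2) ^ (betti1 X - 1) * (1 + u) ^+ #|legs X| *
        \det (1%:M - u *: (C *m A) + u ^+ 2 *: (C *m Q - 1%:M)).
Proof.
(* This is [radius / 4], taken in the real field. *)
move=> n A Q C; exists ((4 * #|step X|.+1%:R)^-1 / 4) => [|u].
  by rewrite divr_gt0 // invr_gt0 mulr_gt0.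
have -> : (((4 * #|step X|.+1%:R)^-1 / 4)%:C : R[i]) = radius R[i] X / 4.
  by rewrite rmorphM fmorphV rmorphM !rmorph_nat fmorphV rmorph_nat.
have [D [detD coefD]] := euler_polyE R[i] X.
move=> ur; have [cz ->] := ihara_zeta_limit _ _ _ coefD u (@complex_archimedean R) ur.
split=> //; rewrite detD; apply: det_transfer_mx.
(* The disc lies inside the unit disc, so [1 - u ^+ 2] is invertible. *)
have u1 : `|u| < 1.
  apply: lt_le_trans ur _; rewrite ler_pdivrMr // mul1r.
  rewrite (@le_trans _ _ 1) ?ler1n // invf_le1 ?mulr_gt0 //.
  by rewrite -natrM ler1n.
rewrite subr_eq0 eq_sym; apply/eqP => u2.
have : `|u| ^+ 2 < 1 by rewrite expr_lt1.
by rewrite -normrX u2 normr1 ltxx.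
Qed.
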